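(* Let the data set $P$, the regions $I_i$, the domains $\tilde I_k$, the assignment $\gamma$, the maps $L_{i,k}$, the contractivity factors $s_i,s_i',\tilde s_i,\tilde s_i'$, the functions $q_{i,k},\tilde q_{i,k}$, the maps $\vec F_{i,k}$, the bounded set $D\subset\mathbb R^2$ and the transformations $\vec W_i:\tilde I_k\times D\to I_i\times\mathbb R^2$ ($i=1,\dots,n$, $k=\gamma(i)$) be as described in the context, and let $$\overline S=\max\{\overline{s}_i+\overline{\tilde s}_i,\ \overline{s'}_i+\overline{\tilde s'}_i\ :\ i=1,\dots,n\}.$$ If $\overline S<1$, then there exists a distance $\rho_\theta$ on $\mathbb R^3$, equivalent to the Euclidean metric, such that every $\vec W_i$ ($i=1,\dots,n$) is a contraction transformation with respect to $\rho_\theta$.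
   Context: Data: $P=\{(x_i,\vec y_i)\in\mathbb R^3: i=0,1,\dots,n\}$ with $-\infty<x_0<x_1<\dots<x_n<\infty$ and $\vec y_i=(y_i,z_i)\in\mathbb R^2$ (the $y_i$ are given data values, the $z_i$ are arbitrary real parameters). Put $I=[x_0,x_n]$ and $I_i=[x_{i-1},x_i]$ for $i=1,\dots,n$ (the ''regions''). Domains: $l$ is an integer with $2\le l\le n$. For $k=1,\dots,l$, $\tilde I_k=[x_{s(k)},x_{e(k)}]\subset I$ is a subinterval (a ''domain'') with $s(k),e(k)\in\{0,\dots,n\}$ and $e(k)-s(k)\ge 2$. For each $i\in\{1,\dots,n\}$ an index $k=\gamma(i)\in\{1,\dots,l\}$ is chosen; below $k$ always means $\gamma(i)$. Maps $L_{i,k}$: $L_{i,k}:\tilde I_k\to I_i$ is a contraction homeomorphism (a homeomorphism that is Lipschitz with constant less than 1) with $L_{i,k}(\{x_{s(k)},x_{e(k)}\})=\{x_{i-1},x_i\}$. Maps $\vec F_{i,k}$: for $i=1,\dots,n$, $\vec F_{i,k}:\tilde I_k\times\mathbb R^2\to\mathbb R^2$ is defined, for $\vec y=(y,z)$, by $$\vec F_{i,k}(x,\vec y)=\begin{pmatrix} s_i(L_{i,k}(x))\,y+s_i'(L_{i,k}(x))\,z+q_{i,k}(x)\\ \tilde s_i(L_{i,k}(x))\,y+\tilde s_i'(L_{i,k}(x))\,z+\tilde q_{i,k}(x)\end{pmatrix},$$ where $s_i,s_i',\tilde s_i,\tilde s_i':I_i\to\mathbb R$ are Lipschitz functions whose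 absolute values are less than 1 (here $'$ is only a label, not a derivative), and $q_{i,k},\tilde q_{i,k}:\tilde I_k\to\mathbb R$ are Lipschitz functions such that: whenever $\alpha\in\{s(k),e(k)\}$, $a\in\{i-1,i\}$ and $L_{i,k}(x_\alpha)=x_a$, one has $\vec F_{i,k}(x_\alpha,\vec y_\alpha)=\vec y_a$. Transformations: $D\subset\mathbb R^2$ is a (sufficiently large) bounded set containing all $\vec y_i$, $i=0,\dots,n$, and $\vec W_i:\tilde I_k\times D\to I_i\times\mathbb R^2$, $\vec W_i(x,\vec y)=(L_{i,k}(x),\vec F_{i,k}(x,\vec y))$. Notation: for a function $f$, $\overline f=\max_x|f(x)|$, the maximum being over the domain of $f$; thus $\overline{s}_i=\max_{I_i}|s_i|$, $\overline{s'}_i=\max_{I_i}|s_i'|$, $\overline{\tilde s}_i=\max_{I_i}|\tilde s_i|$, $\overline{\tilde s'}_i=\max_{I_i}|\tilde s_i'|$. A contraction transformation is a Lipschitz map with Lipschitz constant less than 1. *)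

(* Defs.v *)
From HB Require Import structures.
From mathcomp Require Import all_boot all_order all_algebra.
From mathcomp Require Import all_classical all_reals all_analysis.
Set Implicit Arguments.
Unset Strict Implicit.
Unset Printing Implicit Defensive.
Import Order.TTheory GRing.Theory Num.Theory.
Import numFieldNormedType.Exports.
Local Open Scope classical_set_scope.
Local Open Scope ring_scope.

Definition is_distance (R : realType) (T : Type) (d : T -> T -> R) : Prop :=
  [/\ forall p q, 0 <= d p q,
      forall p q, d p q = 0 <-> p = q,
      forall p q, d p q = d q p
    & forall p q r, d p r <= d p q + d q r].

(* Equivalence of distances in the sense of two-sided Lipschitz bounds; it
   implies that both distances induce the same topology. *)
Definition equivalent_distances (R : realType) (T : Type)
    (d d' : T -> T -> R) : Prop :=
  exists c C : R, [/\ 0 < c, 0 < C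
    & forall p q, c * d p q <= d' p q <= C * d p q].

(* R^3 is represented as R * (R * R), a point being (x, (y, z)). *)
Definition euclidean_distance (R : realType) (p q : R * (R * R)) : R :=
  Num.sqrt ((p.1 - q.1) ^+ 2 + (p.2.1 - q.2.1) ^+ 2 + (p.2.2 - q.2.2) ^+ 2).

Definition contraction_on (R : realType) (T U : Type)
    (dT : T -> T -> R) (dU : U -> U -> R) (A : set T) (f : T -> U) : Prop :=
  exists2 c : R, 0 <= c < 1 &
    forall p q, A p -> A q -> dU (f p) (f q) <= c * dT p q.

Definition homeomorphism_on (T U : topologicalType) (A : set T) (B : set U)
    (f : T -> U) : Prop :=
  [/\ set_fun A B f, {within A, continuous f}
    & exists g : U -> T, [/\ set_fun B A g, {within B, continuous g},
        {in A, cancel f g} & {in B, cancel g f}]].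

(* The maximum of |f| on A; see max_abs_max for the fact that the supremum is
   a maximum when f is continuous on a segment A. *)
Definition max_abs (R : realType) (A : set R) (f : R -> R) : R :=
  sup [set `|f t| | t in A].

Lemma max_abs_max (R : realType) (a b : R) (f : R -> R) :
  a <= b -> {within `[a, b], continuous f} ->
  (exists2 c, c \in `[a, b] & max_abs `[a, b] f = `|f c|) /\
  (forall t, t \in `[a, b] -> `|f t| <= max_abs `[a, b] f).
Proof.
move=> ab cf.
have cnf : {within `[a, b], continuous (fun t => `|f t|)}.
  by move=> t; apply: cvg_norm; exact: cf.
have [c cab cmax] := EVT_max ab cnf.
have E : max_abs `[a, b] f = `|f c|.
  apply/eqP; rewrite eq_le; apply/andP; split.
    apply: ge_sup; first by exists `|f c|, c.
    by move=> _ [t tab <-]; exact: cmax.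
  apply: ub_le_sup; last by exists c.
  by exists `|f c| => _ [t tab <-]; exact: cmax.
split; first by exists c => //; rewrite inE.
by move=> t; rewrite inE /= => tab; rewrite E; exact: cmax.
Qed.

(* The nodes are x_0, ..., x_n, indexed by 'I_n.+1.  The index i : 'I_n stands
   for the (i+1)-st region [x_i, x_(i+1)], whose end points have indices
   left_node i and right_node i. *)
Definition left_node (n : nat) (i : 'I_n) : 'I_n.+1 := widen_ord (leqnSn n) i.

Definition right_node (n : nat) (i : 'I_n) : 'I_n.+1 := lift ord0 i.

Definition region (R : realType) (n : nat) (x : 'I_n.+1 -> R) (i : 'I_n)
  : set R := `[x (left_node i), x (right_node i)].

Definition domain (R : realType) (n l : nat) (x : 'I_n.+1 -> R)
    (start fin : 'I_l -> 'I_n.+1) (k : 'I_l) : set R :=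
  `[x (start k), x (fin k)].

(* F_(i,k), where Li, si, si', ti, ti' are L_(i,k) and the four contractivity
   factors s_i, s_i', \tilde s_i, \tilde s_i', and qi, ri are q_(i,k) and
   \tilde q_(i,k). *)
Definition Fmap (R : realType) (Li si si' ti ti' qi ri : R -> R)
    (t : R) (v : R * R) : R * R :=
  (si (Li t) * v.1 + si' (Li t) * v.2 + qi t,
   ti (Li t) * v.1 + ti' (Li t) * v.2 + ri t).

Definition Wmap (R : realType) (Li si si' ti ti' qi ri : R -> R)
    (p : R * (R * R)) : R * (R * R) :=
  (Li p.1, Fmap Li si si' ti ti' qi ri p.1 p.2).

(* Starting the iterated maximum at 0 is harmless, all terms being
   nonnegative. *)
Definition Sbar (R : realType) (n : nat) (x : 'I_n.+1 -> R)
    (s s' t t' : 'I_n -> R -> R) : R :=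
  \big[Num.max/0]_(i < n)
    Num.max (max_abs (region x i) (s i) + max_abs (region x i) (t i))
            (max_abs (region x i) (s' i) + max_abs (region x i) (t' i)).

(* Main.v *)
(* The distance is |x - x'| + theta (|y - y'| + |z - z'|).  On a region the
   four factors expand the taxicab distance of the second coordinates at most
   by Sbar < 1; the variation in x of the factors, over the bounded set D, and
   of q, r adds at most K |x - x'|.  If c < 1 is the contraction constant of L,
   the transformation contracts as soon as c + theta K < 1, which holds for all
   small theta, hence simultaneously for the finitely many i. *)

Require Import Defs.
From HB Require Import structures.
From mathcomp Require Import all_boot all_order all_algebra.
From mathcomp Require Import all_classical all_reals all_analysis.
From mathcomp Require Import ring lra.
Import Order.TTheory GRing.Theory Num.Theory.
Import numFieldNormedType.Exports.
Local Open Scope classical_set_scope.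
Local Open Scope ring_scope.

Definition weighted_taxicab {R : realType} (theta : R)
    (p q : R * (R * R)) : R :=
  `|p.1 - q.1| + theta * (`|p.2.1 - q.2.1| + `|p.2.2 - q.2.2|).

Lemma weighted_taxicab_distance (R : realType) (theta : R) :
  0 < theta -> is_distance (weighted_taxicab theta).
Proof.
move=> theta0; have theta_ge0 := ltW theta0; rewrite /weighted_taxicab.
split => [p q|p q|p q|p q r].
- by rewrite addr_ge0// mulr_ge0// addr_ge0.
- split=> [|->]; last by rewrite !subrr normr0 addr0 mulr0 addr0.
  move: p q => [x [y z]] [x' [y' z']] /= /eqP.
  (* Since [theta] is nonzero, the weighted term vanishes only when both of its summands do. *)
  rewrite paddr_eq0 ?mulr_ge0 ?addr_ge0// mulf_eq0 (gt_eqF theta0)/= paddr_eq0//.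
  by rewrite !normr_eq0 !subr_eq0 => /and3P[/eqP-> /eqP-> /eqP->].
- by rewrite (distrC p.1) (distrC p.2.1) (distrC p.2.2).
- have := ler_distD q.2.1 p.2.1 r.2.1; have := ler_distD q.2.2 p.2.2 r.2.2.
  have := ler_distD q.1 p.1 r.1; nra.
Qed.

(** The Euclidean distance dominates each of the three coordinate differences, which gives the
    factor [1 + 2 * theta], and is at most their sum, which gives [Num.min 1 theta]. *)
Lemma weighted_taxicab_equivalent (R : realType) (theta : R) :
  0 < theta ->
  equivalent_distances (@euclidean_distance R) (weighted_taxicab theta).
Proof.
move=> theta0; exists (Num.min 1 theta), (1 + 2 * theta).
split; [by rewrite lt_min ltr01 | by lra |] => p q.
rewrite /weighted_taxicab /euclidean_distance.
(* Squares are rewritten as squares of absolute values, so that both distances become expressions in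
   the same three nonnegative numbers. *)
rewrite -(real_normK (num_real (p.1 - q.1))).
rewrite -(real_normK (num_real (p.2.1 - q.2.1))).
rewrite -(real_normK (num_real (p.2.2 - q.2.2))).
move: `|p.1 - q.1| `|p.2.1 - q.2.1| `|p.2.2 - q.2.2|
  (normr_ge0 (p.1 - q.1)) (normr_ge0 (p.2.1 - q.2.1))
  (normr_ge0 (p.2.2 - q.2.2)) => a b c a0 b0 c0.
set e := Num.sqrt _.
have e0 : 0 <= e by exact: sqrtr_ge0.
have ee : e ^+ 2 = a ^+ 2 + b ^+ 2 + c ^+ 2.
  by rewrite sqr_sqrtr// !addr_ge0 ?sqr_ge0.
have le_e w : 0 <= w -> w ^+ 2 <= e ^+ 2 -> w <= e.
  by move=> w0; rewrite ler_pXn2r.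
have ae : a <= e by apply: le_e => //; rewrite ee; nra.
have be : b <= e by apply: le_e => //; rewrite ee; nra.
have ce : c <= e by apply: le_e => //; rewrite ee; nra.
have e_sum : e <= a + b + c.
  by rewrite -(@ler_pXn2r _ 2)// ?nnegrE ?addr_ge0// ee; nra.
apply/andP; split; last by nra.
(* With [m] this minimum, [m * e <= m * (a + b + c) <= a + theta * (b + c)]. *)
have m1 : Num.min 1 theta <= 1 by rewrite ge_min lexx.
have mt : Num.min 1 theta <= theta by rewrite ge_min lexx orbT.
have m0 : 0 <= Num.min 1 theta by rewrite le_min ler01 ltW.
by move: (Num.min 1 theta) m1 mt m0 => m m1 mt m0; nra.
Qed.

Lemma lipschitz_dist (R : realType) (A : set R) (f : R -> R) :
  [lipschitz f u | u in A] ->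
  exists2 K, 0 <= K & forall u v, A u -> A v -> `|f u - f v| <= K * `|u - v|.
Proof.
move=> /pinfty_ex_gt0[K K0 HK]; exists K; first exact: ltW.
by move=> u v Au Av; exact: (HK (u, v)).
Qed.

(** The norm on pairs is the maximum norm, so a norm bound is a bound on both coordinates. *)
Lemma bounded_set_pair (R : realType) (D : set (R * R)) : bounded_set D ->
  exists2 M, 0 <= M & forall v, D v -> `|v.1| <= M /\ `|v.2| <= M.
Proof.
move=> /pinfty_ex_gt0[M M0 HM]; exists M; first exact: ltW.
move=> v Dv; have /= := HM v Dv; rewrite prod_normE/= ge_max.
by move=> /andP[].
Qed.

(** On a set without upper bound [sup] takes a default value; a uniform bound [M], whatever its
    size, ensures that the supremum dominates the values. *)
Lemma max_abs_ge (R : realType) (A : set R) (f : R -> R) (M u : R) :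
  (forall v, A v -> `|f v| <= M) -> A u -> `|f u| <= max_abs A f.
Proof.
move=> fM Au; apply: ub_le_sup; last by exists u.
by exists M => _ [v Av <-]; exact: fM.
Qed.

(** This treats one row of [Fmap]. The factors are frozen at [Li u]; their variation multiplies
    entries of [v'], bounded by [M], so it costs only a multiple of the distance from [u] to [u'].
    Keeping pointwise values of the factors allows the two rows to be added column by column
    later. *)
Lemma dist_affine_le (R : realType) (A B : set R) (D : set (R * R))
    (Li f g h : R -> R) (M : R) :
  0 <= M -> (forall v, D v -> `|v.1| <= M /\ `|v.2| <= M) ->
  (forall u, A u -> B (Li u)) ->
  (forall u v, A u -> A v -> `|Li u - Li v| <= `|u - v|) ->
  [lipschitz f u | u in B] -> [lipschitz g u | u in B] ->
  [lipschitz h u | u in A] ->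
  exists2 K, 0 <= K & forall u u' v v', A u -> A u' -> D v -> D v' ->
    `|(f (Li u) * v.1 + g (Li u) * v.2 + h u)
       - (f (Li u') * v'.1 + g (Li u') * v'.2 + h u')|
    <= `|f (Li u)| * `|v.1 - v'.1| + `|g (Li u)| * `|v.2 - v'.2|
       + K * `|u - u'|.
Proof.
move=> M0 DM LAB L1 /lipschitz_dist[Kf Kf0 fK] /lipschitz_dist[Kg Kg0 gK].
move=> /lipschitz_dist[Kh Kh0 hK].
exists (Kf * M + Kg * M + Kh); first by rewrite !addr_ge0 ?mulr_ge0.
move=> u u' v v' Au Au' Dv Dv'; have [v'1 v'2] := DM _ Dv'.
have Luu' := L1 _ _ Au Au'.
(* By [L1], a Lipschitz bound between image points is also one between [u] and [u']. *)
have dfM : `|(f (Li u) - f (Li u')) * v'.1| <= Kf * M * `|u - u'|.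
  rewrite normrM mulrAC ler_pM//.
  by apply: le_trans (fK _ _ (LAB _ Au) (LAB _ Au')) _; exact: ler_wpM2l.
have dgM : `|(g (Li u) - g (Li u')) * v'.2| <= Kg * M * `|u - u'|.
  rewrite normrM mulrAC ler_pM//.
  by apply: le_trans (gK _ _ (LAB _ Au) (LAB _ Au')) _; exact: ler_wpM2l.
have dh := hK _ _ Au Au'.
rewrite [X in `|X|](_ : _ = f (Li u) * (v.1 - v'.1) + g (Li u) * (v.2 - v'.2)
  + ((f (Li u) - f (Li u')) * v'.1 + (g (Li u) - g (Li u')) * v'.2
     + (h u - h u'))); last by ring.
rewrite -!normrM 2![_ * `|u - u'|]mulrDl; apply: le_trans (ler_normD _ _) _.
apply: lerD; first exact: ler_normD.
apply: le_trans (ler_normD _ _) _; apply: lerD => //.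
by apply: le_trans (ler_normD _ _) _; exact: lerD.
Qed.

(** The taxicab operator norm of a matrix is its largest absolute column sum, here at most [S] at
    every point of [B]. The conclusion is eventual in [theta] so that several maps can share one
    weight. *)
Lemma Wmap_contraction_near (R : realType) (A B : set R) (D : set (R * R))
    (Li si si' ti ti' qi ri : R -> R) (S : R) :
  bounded_set D ->
  (forall u, A u -> B (Li u)) ->
  contraction_on (fun u v : R => `|u - v|) (fun u v : R => `|u - v|) A Li ->
  [lipschitz si u | u in B] -> [lipschitz si' u | u in B] ->
  [lipschitz ti u | u in B] -> [lipschitz ti' u | u in B] ->
  [lipschitz qi u | u in A] -> [lipschitz ri u | u in A] ->
  0 <= S < 1 ->
  (forall u, B u -> `|si u| + `|ti u| <= S) ->
  (forall u, B u -> `|si' u| + `|ti' u| <= S) ->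
  \forall theta \near 0^'+,
    contraction_on (weighted_taxicab theta) (weighted_taxicab theta)
      (A `*` D) (Wmap Li si si' ti ti' qi ri).
Proof.
move=> /bounded_set_pair[M M0 DM] LAB [c /andP[c0 c1] Lc].
move=> si_lip si'_lip ti_lip ti'_lip qi_lip ri_lip /andP[S0 S1] stS st'S.
have L1 u v : A u -> A v -> `|Li u - Li v| <= `|u - v|.
  move=> Au Av; apply: le_trans (Lc _ _ Au Av) _.
  by rewrite ler_piMl// ltW.
have [K K0 FK] := dist_affine_le _ _ _ _ _ _ _ _ _ M0 DM LAB L1 si_lip si'_lip qi_lip.
have [K' K'0 F'K] := dist_affine_le _ _ _ _ _ _ _ _ _ M0 DM LAB L1 ti_lip ti'_lip ri_lip.
near=> theta.
have theta0 : 0 < theta by near: theta; exact: nbhs_right_gt.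
(* The summand [1] keeps the divisor positive even when [K] and [K'] vanish. *)
have thetaK : theta * (K + K' + 1) < 1 - c.
  rewrite -ltr_pdivlMr; last by rewrite ltr_wpDl// addr_ge0.
  near: theta; apply: nbhs_right_lt; rewrite divr_gt0// ?subr_gt0//.
  by rewrite ltr_wpDl// addr_ge0.
(* The first entry controls the coefficient of the first coordinate difference, the second entry
   those of the other two. *)
exists (Num.max (c + theta * (K + K')) S).
  rewrite le_max S0 orbT/= gt_max S1 andbT; nra.
move=> [u v] [u' v'] [/= Au Dv] [/= Au' Dv'].
rewrite /weighted_taxicab /=.
have := FK _ _ _ _ Au Au' Dv Dv'; have := F'K _ _ _ _ Au Au' Dv Dv'.
have := stS _ (LAB _ Au); have := st'S _ (LAB _ Au).
have := Lc _ _ Au Au'.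
have : c + theta * (K + K') <= Num.max (c + theta * (K + K')) S.
  by rewrite le_max lexx.
have : S <= Num.max (c + theta * (K + K')) S by rewrite le_max lexx orbT.
move: (Num.max _ _) => m Sm cm.
have := normr_ge0 (u - u'); have := normr_ge0 (v.1 - v'.1).
have := normr_ge0 (v.2 - v'.2).
move: `|u - u'| `|v.1 - v'.1| `|v.2 - v'.2| => a b d d0 b0 a0.
move: `|si _| `|si' _| `|ti _| `|ti' _| `|Li u - Li u'| => e e' f f' La.
move=> Lac e'f' ef.
move: `|_ - _| `|_ - _| => G H GH HG.
(* Adding the two rows collects the column sums [e + f] in front of [b] and [e' + f'] in front of
   [d], both at most [S]. *)
have ab : e * b + f * b <= m * b by rewrite -mulrDl ler_wpM2r// (le_trans ef).
have ad : e' * d + f' * d <= m * d.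
  by rewrite -mulrDl ler_wpM2r// (le_trans e'f').
have aa : c * a + theta * (K + K') * a <= m * a.
  by rewrite -mulrDl ler_wpM2r.
have HGm : H + G <= m * b + m * d + (K + K') * a by lra.
have := ler_wpM2l (ltW theta0) HGm; nra.
Unshelve. all: by end_near. Qed.

Theorem theorem1 (R : realType) (n l : nat)
  (x : 'I_n.+1 -> R) (y : 'I_n.+1 -> R * R)
  (x_incr : forall i j : 'I_n.+1, (i < j)%N -> x i < x j)
  (l_bounds : (2 <= l <= n)%N)
  (start fin : 'I_l -> 'I_n.+1)
  (domain_long : forall k : 'I_l, (2 <= fin k - start k)%N)
  (gamma : 'I_n -> 'I_l)
  (L : 'I_n -> R -> R)
  (L_homeo : forall i : 'I_n,
     homeomorphism_on (domain x start fin (gamma i)) (region x i) (L i))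
  (L_contr : forall i : 'I_n,
     contraction_on (fun u v : R => `|u - v|) (fun u v : R => `|u - v|)
       (domain x start fin (gamma i)) (L i))
  (L_ends : forall i : 'I_n,
     L i @` [set x (start (gamma i)); x (fin (gamma i))] =
     [set x (left_node i); x (right_node i)])
  (s s' t t' : 'I_n -> R -> R)
  (s_lip : forall i : 'I_n, [lipschitz s i u | u in region x i])
  (s'_lip : forall i : 'I_n, [lipschitz s' i u | u in region x i])
  (t_lip : forall i : 'I_n, [lipschitz t i u | u in region x i])
  (t'_lip : forall i : 'I_n, [lipschitz t' i u | u in region x i])
  (s_lt1 : forall (i : 'I_n) (u : R), region x i u -> `|s i u| < 1)
  (s'_lt1 : forall (i : 'I_n) (u : R), region x i u -> `|s' i u| < 1)
  (t_lt1 : forall (i : 'I_n) (u : R), region x i u -> `|t i u| < 1)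
  (t'_lt1 : forall (i : 'I_n) (u : R), region x i u -> `|t' i u| < 1)
  (q r : 'I_n -> R -> R)
  (q_lip : forall i : 'I_n,
     [lipschitz q i u | u in domain x start fin (gamma i)])
  (r_lip : forall i : 'I_n,
     [lipschitz r i u | u in domain x start fin (gamma i)])
  (F_join : forall (i : 'I_n) (alpha a : 'I_n.+1),
     alpha \in [:: start (gamma i); fin (gamma i)] ->
     a \in [:: left_node i; right_node i] ->
     L i (x alpha) = x a ->
     Fmap (L i) (s i) (s' i) (t i) (t' i) (q i) (r i) (x alpha) (y alpha) = y a)
  (D : set (R * R))
  (D_bounded : bounded_set D)
  (D_data : forall i : 'I_n.+1, D (y i)) :
  Sbar x s s' t t' < 1 ->
  exists rho : R * (R * R) -> R * (R * R) -> R,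
    [/\ is_distance rho,
        equivalent_distances (@euclidean_distance R) rho
      & forall i : 'I_n,
          contraction_on rho rho
            (domain x start fin (gamma i) `*` D)
            (Wmap (L i) (s i) (s' i) (t i) (t' i) (q i) (r i))].

Proof.
move=> S1.
have L_maps i u : domain x start fin (gamma i) u -> region x i (L i u).
  by have [+ _ _] := L_homeo i; exact.
(* The bound [1] on the factors makes their suprema genuine upper bounds. *)
have le_max_abs i (f : R -> R) u : (forall v, region x i v -> `|f v| < 1) ->
    region x i u -> `|f u| <= max_abs (region x i) f.
  by move=> f1; apply: (@max_abs_ge _ _ _ 1) => v /f1/ltW.
have S_ge i := le_bigmax (0 : R) (fun i =>
  Num.max (max_abs (region x i) (s i) + max_abs (region x i) (t i))
          (max_abs (region x i) (s' i) + max_abs (region x i) (t' i))) i.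
have : \forall theta \near 0^'+, forall i : 'I_n,
    contraction_on (weighted_taxicab theta) (weighted_taxicab theta)
      (domain x start fin (gamma i) `*` D)
      (Wmap (L i) (s i) (s' i) (t i) (t' i) (q i) (r i)).
  (* Finitely many eventual properties hold together eventually. *)
  apply: filter_forall => i.
  apply: (@Wmap_contraction_near _ _ (region x i) _ _ _ _ _ _ _ _
    (Sbar x s s' t t')) => //.
  - exact: L_maps.
  (* Nonnegativity of [Sbar] comes from starting the iterated maximum at [0]. *)
  - by rewrite S1 andbT; exact: bigmax_ge_id.
  - move=> u xu; apply: le_trans (S_ge i); rewrite le_max; apply/orP; left.
    by apply: lerD; apply: le_max_abs => //; [exact: s_lt1|exact: t_lt1].
  - move=> u xu; apply: le_trans (S_ge i); rewrite le_max; apply/orP; right.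
    by apply: lerD; apply: le_max_abs => //; [exact: s'_lt1|exact: t'_lt1].
(* The filter of right neighborhoods excludes [0] itself, so the chosen weight is positive. *)
move=> W_contr; near (0 : R)^'+ => theta.
have theta0 : 0 < theta by near: theta; exact: nbhs_right_gt.
exists (weighted_taxicab theta); split.
- exact: weighted_taxicab_distance.
- exact: weighted_taxicab_equivalent.
- by near: theta.
Unshelve. all: by end_near. Qed.
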